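(* Let $R$ be an associative ring with unity and let $G$ be a subgroup of the multiplicative group $R^*$. Then, for every generalised homogeneous system of equations over $R$ in $n$ unknowns $x_1,\dots,x_n$, the number of solutions lying in $G^n$ is divisible by the order of $G\cap C(S)$, where $S$ is the set of coefficients of the system and $C(S)$ its centraliser in $R$.
   Context: An equation over $R$ with unknowns $X=\{x_1,\dots,x_n\}$ here has the form $\sum_i\prod_j c_{ij}x_{ij}^{k_{ij}}=0$ (finitely many terms, each a finite product) with coefficients $c_{ij}\in R$, $x_{ij}\in X$, exponents $k_{ij}\in\mathbb{Z}$. A system of such equations is generalised homogeneous if there is a nonzero map $\deg: X\to\mathbb{Z}$ such that, in each equation, $\sum_j k_{ij}\deg(x_{ij})$ does not depend on $i$ (same map $\deg$ for all equations). A solution is a tuple of ring elements which, substituted for the unknowns, satisfies all equations (components raised to negative powers must be invertible). Divisibility is in the sense of cardinal arithmetic: an infinite cardinal is divisible by every nonzero cardinal not exceeding it. *)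

(* Defs.v *)
From HB Require Import structures.
From mathcomp Require Import all_boot all_order all_algebra.
Set Implicit Arguments. Unset Strict Implicit. Unset Printing Implicit Defensive.
Import Order.TTheory GRing.Theory Num.Theory.
Local Open Scope ring_scope.

Definition unit_subgroup (R : pzRingType) (G : R -> Prop) : Prop :=
  [/\ G 1,
      (forall a b, G a -> G b -> G (a * b)) &
      (forall a, G a -> exists2 b, G b & a * b = 1 /\ b * a = 1)].

(* A factor  c * x_i ^ k  is encoded as ((c, i), k). *)
Definition factor (R : Type) (n : nat) := (R * 'I_n * int)%type.
(* A term (monomial) is a finite product of factors, in the given order. *)
Definition term (R : Type) (n : nat) := seq (factor R n).
(* An equation  sum_i prod_j c_ij x_ij^k_ij = 0  is a finite list of terms. *)
Definition equation (R : Type) (n : nat) := seq (term R n).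

(* x ^ k for k : int, where xinv is the (two-sided) inverse of x. *)
Definition ipow (R : pzRingType) (x xinv : R) (k : int) : R :=
  match k with
  | Posz m => x ^+ m
  | Negz m => xinv ^+ m.+1
  end.

Definition eval_term (R : pzRingType) n (x xinv : 'I_n -> R) (t : term R n) : R :=
  foldr (fun f acc => f.1.1 * ipow (x f.1.2) (xinv f.1.2) f.2 * acc) 1 t.

Definition eval_eq (R : pzRingType) n (x xinv : 'I_n -> R) (e : equation R n) : R :=
  foldr (fun t acc => eval_term x xinv t + acc) 0 e.

Definition term_deg (R : Type) n (deg : 'I_n -> int) (t : term R n) : int :=
  foldr (fun f acc => f.2 * deg f.1.2 + acc) 0 t.

Definition gen_homogeneous (R : pzRingType) n (I : Type) (E : I -> equation R n) : Prop :=
  exists deg : 'I_n -> int,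
    (exists j, deg j != 0) /\
    forall (e : I) (t1 t2 : term R n), t1 \in E e -> t2 \in E e ->
      term_deg deg t1 = term_deg deg t2.

Definition coeff_of (R : pzRingType) n (I : Type) (E : I -> equation R n) (s : R) : Prop :=
  exists e : I, exists2 t, t \in E e & exists2 f, f \in t & f.1.1 = s.

Definition centralises (R : pzRingType) (S : R -> Prop) (r : R) : Prop :=
  forall s, S s -> r * s = s * r.

(* x is a solution of the system lying in G^n.  Negative powers use the
   (unique) two-sided inverses xinv of the components. *)
Definition sol_in (R : pzRingType) n (I : Type) (E : I -> equation R n)
  (G : R -> Prop) (x : 'I_n -> R) : Prop :=
  (forall i, G (x i)) /\
  exists xinv : 'I_n -> R,
    (forall i, x i * xinv i = 1 /\ xinv i * x i = 1) /\
    (forall e : I, eval_eq x xinv (E e) = 0).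

Definition card_dvd (A B : Type) : Prop :=
  exists (M : Type) (f : A * M -> B), bijective f.

(* Main.v *)
(** Let H be the intersection of G with the centraliser of the coefficients, and
rescale the degree map so that some word w1 in the unknowns has degree 1.  For a
solution x let K be the largest subgroup of H normalised by the values at x of
all words and centralised by those of the words of degree 0.  Put t := w1(x).
For k in K, multiplying the value of every word of degree d on the right by
t^-d (t k)^d, an element of K, gives another tuple, the twist of x by k; this
multiplies every term of degree d on the right by that same element, hence by
homogeneity preserves solutions.  Conjugation by H also preserves solutions.
The elements of H that conjugate the block of twists of x into itself are
exactly those of K, and this block is in bijection with K; so each class of
solutions for "twist, then conjugate by H" has |H : K| |K| = |H| elements. *)

Require Import Defs.
From HB Require Import structures.
From mathcomp Require Import all_boot all_order all_algebra.
From mathcomp Require Import boolp.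
Set Implicit Arguments. Unset Strict Implicit. Unset Printing Implicit Defensive.
Import GRing.Theory.
Local Open Scope ring_scope.

(** * Bijections, cardinal divisibility and choice of class representatives *)

Lemma inj_surj_bij (A B : Type) (f : A -> B) :
  injective f -> (forall b, exists a, f a = b) -> bijective f.
Proof.
move=> finj /choice[g fg]; exists g => // a.
by apply: finj; rewrite fg.
Qed.

Lemma sig_bij (A B : Type) (P : A -> Prop) (Q : B -> Prop) (f : A -> B) :
  injective f -> (forall a, P a -> Q (f a)) ->
  (forall b, Q b -> exists2 a, P a & f a = b) ->
  exists F : {a | P a} -> {b | Q b}, bijective F.
Proof.
move=> finj fPQ fsurj.
exists (fun a => exist Q (f (sval a)) (fPQ _ (svalP a))).
apply: inj_surj_bij => [[a Pa] [a' Pa'] /= /(congr1 sval)/= /finj|[b Qb]].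
  exact: eq_exist.
have [a Pa fab] := fsurj b Qb.
by exists (exist _ a Pa); apply: eq_exist.
Qed.

Lemma card_dvd_bij (A A' B B' : Type) (f : A' -> A) (g : B' -> B) :
  bijective f -> bijective g -> card_dvd A' B' -> card_dvd A B.
Proof.
move=> [f' fK f'K] gbij [M [F Fbij]].
exists M, (g \o F \o (fun p => (f' p.1, p.2))).
apply: bij_comp; first exact: bij_comp.
by exists (fun p => (f p.1, p.2)) => -[a m] /=; rewrite ?fK ?f'K.
Qed.

(** Equivalent elements have extensionally equal classes, and [choose] returns the same element of a
    class from any starting point in it. *)
Lemma equiv_repr (T : Type) (R : T -> T -> Prop) :
  (forall x, R x x) -> (forall x y, R x y -> R y x) ->
  (forall x y z, R x y -> R y z -> R x z) ->
  exists rep : T -> T,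
    (forall x, R x (rep x)) /\ (forall x y, R x y -> rep x = rep y).
Proof.
move=> Rr Rs Rt.
pose P (x : T) : pred {classic T} := fun y => `[< R x y >].
exists (fun x => choose (P x) x); split=> [x|x y Rxy].
  have /asboolP := @chooseP {classic T} (P x) x (asboolT (Rr x)); exact.
have -> : P x = P y.
  apply: funext => z; apply: asbool_equiv_eq; split; apply: Rt => //.
  exact: Rs.
by apply: (@choose_id {classic T}); apply/asboolP => //; apply: Rs.
Qed.

(** * Two-sided induction on integers; integer powers in a group *)

Lemma int_step_ind (P : int -> Prop) :
  P 0 -> (forall k, P k <-> P (1 + k)) -> forall k, P k.
Proof.
move=> P0 PS; elim=> [//|n IH|n IH].
  by rewrite -addn1 addnC PoszD; apply: (PS n).1.
by apply: (PS _).2; rewrite -addn1 PoszD opprD addrCA subrr addr0.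
Qed.

Section IntegerPowers.
Local Open Scope group_scope.
Context {gT : groupType}.
Implicit Type x : gT.

Definition zpow x (k : int) : gT :=
  match k with Posz m => x ^+ m | Negz m => x ^- m.+1 end.

Lemma zpow1 x : zpow x 1 = x. Proof. by []. Qed.

Lemma zpow_succ x k : zpow x (1 + k)%R = x * zpow x k.
Proof.
case: k => [m|[|m]]; first by rewrite /= expgS.
  by rewrite /= mulgV.
rewrite (_ : (1 + Negz m.+1)%R = Negz m).
  by rewrite /= (expgSr x m.+1) invgM mulVKg.
by rewrite !NegzE -(addn1 m.+1) PoszD opprD addrCA subrr addr0.
Qed.

Lemma zpowD x k l : zpow x (k + l)%R = zpow x k * zpow x l.
Proof.
elim/int_step_ind: k => [|k]; first by rewrite add0r mul1g.
rewrite -addrA !zpow_succ -mulgA; split=> [-> //|]; exact: mulgI.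
Qed.

End IntegerPowers.

(** * Words in the unknowns, their values and degrees *)

Section Words.
Local Open Scope group_scope.
Context {gT : groupType} {X : Type}.
Implicit Types (x : X -> gT) (u v : seq (X * int)).

Definition word_val x u : gT :=
  foldr (fun f acc => zpow (x f.1) f.2 * acc) 1 u.

Definition word_deg (deg : X -> int) u : int :=
  foldr (fun f acc => f.2 * deg f.1 + acc)%R 0%R u.

Definition word_scale (k : int) u := [seq (f.1, k * f.2)%R | f <- u].

Lemma word_val_cat x u v : word_val x (u ++ v) = word_val x u * word_val x v.
Proof. by elim: u => [|f u IH] /=; rewrite ?mul1g // IH mulgA. Qed.

Lemma word_deg_cat deg u v :
  word_deg deg (u ++ v) = (word_deg deg u + word_deg deg v)%R.
Proof. by elim: u => [|f u IH] /=; rewrite ?add0r // IH addrA. Qed.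

Lemma word_deg_scale deg k u :
  word_deg deg (word_scale k u) = (k * word_deg deg u)%R.
Proof. by elim: u => [|f u IH] /=; rewrite ?mulr0 // IH mulrDr mulrA. Qed.

Lemma word_val_letter x i : word_val x [:: (i, 1%R)] = x i.
Proof. by rewrite /= mulg1. Qed.

Lemma zpowJ (a : gT) k h : zpow a k ^ h = zpow (a ^ h) k.
Proof. by case: k => m /=; rewrite ?conjVg conjXg. Qed.

Lemma word_valJ x u h : word_val (fun i => x i ^ h) u = word_val x u ^ h.
Proof. by elim: u => [|f u IH] /=; rewrite ?conj1g // conjMg IH zpowJ. Qed.

End Words.

(** By Bezout, the gcd of the degrees of the unknowns is itself the degree of a word; the unknowns
    are added one at a time. *)
Lemma word_deg_dvd (n : nat) (deg : 'I_n -> int) :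
  exists w, forall i, (word_deg deg w %| deg i)%Z.
Proof.
suff [w wP] : exists w, {in enum 'I_n, forall i, (word_deg deg w %| deg i)%Z}.
  by exists w => i; apply: wP; rewrite mem_enum.
elim: (enum 'I_n) => [|i s [w IH]]; first by exists [::].
have [a [b ab]] := Bezoutz (deg i) (word_deg deg w).
exists ((i, a) :: word_scale b w) => j.
rewrite /= word_deg_scale ab inE => /orP[/eqP-> |/IH]; first exact: dvdz_gcdl.
exact/dvdz_trans/dvdz_gcdr.
Qed.

(** * The core of a tuple and the twisting relation *)

Section Twists.
Local Open Scope group_scope.
Context {gT : groupType} {X : Type} (deg : X -> int) (H : gT -> Prop).
Context (w1 : seq (X * int)).
Hypothesis deg_w1 : word_deg deg w1 = 1%R.
Hypotheses (H1 : H 1) (HM : forall a b, H a -> H b -> H (a * b)).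
Hypothesis HV : forall a, H a -> H a^-1.
Implicit Types (x y z : X -> gT) (u v : seq (X * int)).

Local Notation wdeg := (word_deg deg).

(* The subgroup K above: conjugation by the empty word gives membership in [H]. *)
Definition core x (k : gT) : Prop :=
  forall u v, wdeg u = wdeg v ->
    H (k ^ word_val x u) /\ k ^ word_val x u = k ^ word_val x v.

(* Twisting without reference to [w1]: the correction [c] depends on the degree
   only, which makes the relation visibly symmetric. *)
Definition twisted x y : Prop :=
  exists c : int -> gT, (forall d, core x (c d)) /\
    forall v, word_val y v = word_val x v * c (wdeg v).

Definition conjugate x h : X -> gT := fun i => x i ^ h.

Lemma conjugate1 x : conjugate x 1 = x.
Proof. by apply: funext => i; rewrite /conjugate conjg1. Qed.

Lemma conjugateM x g h : conjugate x (g * h) = conjugate (conjugate x g) h.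
Proof. by apply: funext => i; rewrite /conjugate conjgM. Qed.

Lemma HJ a b : H a -> H b -> H (a ^ b).
Proof. by move=> Ha Hb; apply: HM; [apply: HV | apply: HM]. Qed.

Lemma core_sub x k : core x k -> H k.
Proof. by move=> /(_ [::] [::] erefl)[]; rewrite /= conjg1. Qed.

Lemma core1 x : core x 1.
Proof. by move=> u v _; rewrite !conj1g. Qed.

Lemma coreM x k l : core x k -> core x l -> core x (k * l).
Proof.
move=> Kk Kl u v uv; have [Hk ek] := Kk u v uv; have [Hl el] := Kl u v uv.
by rewrite !conjMg -ek -el; split=> //; apply: HM.
Qed.

Lemma coreV x k : core x k -> core x k^-1.
Proof.
move=> Kk u v uv; have [Hk ek] := Kk u v uv.
by rewrite !conjVg -ek; split=> //; apply: HV.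
Qed.

(** Prefixing [w] to both [u] and [v] keeps their degrees equal. *)
Lemma core_word x k w : core x k -> core x (k ^ word_val x w).
Proof.
move=> Kk u v uv; rewrite -!conjgM -!word_val_cat.
by apply: Kk; rewrite !word_deg_cat uv.
Qed.

Lemma coreJ x k h : H h -> core x k -> core (conjugate x h) (k ^ h).
Proof.
move=> Hh Kk u v uv; have [Hk ek] := Kk u v uv.
by rewrite !word_valJ -!conjJg -ek; split=> //; apply: HJ.
Qed.

(** Words act on the core through their degree alone, so powers of [word_val x w1] can stand in for
    them. The value of [word_scale d w1] need not be such a power, hence the induction on the
    degree. *)
Lemma core_zpow x k v : core x k ->
  k ^ zpow (word_val x w1) (wdeg v) = k ^ word_val x v.
Proof.
move=> Kk; have [d vd] : {d | wdeg v = d} by exists (wdeg v).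
rewrite vd; elim/int_step_ind: d v vd => [v v0|d].
  by rewrite conjg1; have [_] := Kk [::] v (esym v0); rewrite conjg1.
have w1d : wdeg (word_scale d w1) = d by rewrite word_deg_scale deg_w1 mulr1.
have zS : zpow (word_val x w1) (1 + d)%R
    = zpow (word_val x w1) d * word_val x w1.
  by rewrite addrC zpowD zpow1.
split=> IH v vd.
  rewrite zS conjgM (IH (word_scale d w1)) //.
  rewrite -conjgM -word_val_cat.
  have [|_ //] := Kk (word_scale d w1 ++ w1) v.
  by rewrite word_deg_cat deg_w1 w1d vd addrC.
apply: (@conjg_inj _ (word_val x w1)); rewrite -conjgM -zS -conjgM -word_val_cat.
by apply: IH; rewrite word_deg_cat deg_w1 vd addrC.
Qed.

(** Passing from [x] to [y] adds a conjugation by [c (wdeg u)], an element of [H] that is the same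
    for [u] and [v]. *)
Lemma twisted_core_sub x y k : twisted x y -> core x k -> core y k.
Proof.
move=> [c [Kc yE]] Kk u v uv; have [Hk ek] := Kk u v uv.
rewrite !yE !conjgM -ek -uv; split=> //.
by apply: HJ => //; apply: core_sub (Kc _).
Qed.

Lemma twisted_refl x : twisted x x.
Proof. by exists (fun=> 1); split=> [d|v]; [apply: core1 | rewrite mulg1]. Qed.

Lemma twisted_sym x y : twisted x y -> twisted y x.
Proof.
move=> Txy; have [c [Kc yE]] := Txy.
exists (fun d => (c d)^-1); split=> [d|v]; last by rewrite yE mulgK.
exact/(twisted_core_sub Txy)/coreV.
Qed.

Lemma twisted_trans x y z : twisted x y -> twisted y z -> twisted x z.
Proof.
move=> Txy [c' [Kc' zE]]; have [c [Kc yE]] := Txy.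
exists (fun d => c d * c' d); split=> [d|v]; last by rewrite zE yE mulgA.
by apply: coreM => //; apply: twisted_core_sub (twisted_sym Txy) (Kc' d).
Qed.

Lemma twistedJ x y h : H h -> twisted x y ->
  twisted (conjugate x h) (conjugate y h).
Proof.
move=> Hh [c [Kc yE]]; exists (fun d => c d ^ h); split=> [d|v].
  exact: coreJ.
by rewrite !word_valJ yE conjMg.
Qed.

(** If [a] is the value of [v], then [a ^ k = a * ((k^-1) ^ a * k)], and the correction depends on
    the degree only, so [word_scale d w1] may replace [v] in it. *)
Lemma twisted_core_conj x k : core x k -> twisted x (conjugate x k).
Proof.
move=> Kk; exists (fun d => (k^-1) ^ word_val x (word_scale d w1) * k).
split=> [d|v]; first by apply: coreM => //; apply/core_word/coreV.
rewrite word_valJ; have [] := coreV Kk (u := word_scale (wdeg v) w1) (v := v).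
  by rewrite word_deg_scale deg_w1 mulr1.
by move=> _ ->; rewrite [LHS]conjgE conjgE !mulgA mulgV mul1g.
Qed.

(** Solving [a ^ h = a * c] for [h ^ a] gives [h * c^-1], which lies in [H] and depends on the
    degree only. Thus the core is the whole stabiliser of the block of twists. *)
Lemma core_stab x h : H h -> twisted x (conjugate x h) -> core x h.
Proof.
move=> Hh [c [Kc xhE]].
have key v : h ^ word_val x v = h * (c (wdeg v))^-1.
  have := xhE v; rewrite word_valJ [word_val x v ^ h]conjgE.
  move=> /(congr1 (fun a => h * a)); rewrite mulVKg => e; apply: (mulIg (c (wdeg v))).
  by rewrite mulgVK conjgE -mulgA -[_ * _ * c _]mulgA -e mulKg.
move=> u v uv; rewrite !key uv; split=> //.
by apply/HM/HV => //; apply: core_sub (Kc _).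
Qed.

(** * The explicit twist by an element of the core *)

Definition twist x k : X -> gT := fun i =>
  let t := word_val x w1 in x i * (zpow t (deg i))^-1 * zpow (t * k) (deg i).

(** The correction satisfies the cocycle rule [cS] with [c 1 = k]. Two-sided induction on the degree
    keeps it in the core, and the same rule collects the corrections of the letters of a word into
    one. *)
Lemma twist_word x k v : core x k ->
  let t := word_val x w1 in let c d := (zpow t d)^-1 * zpow (t * k) d in
  (forall d, core x (c d)) /\ word_val (twist x k) v = word_val x v * c (wdeg v).
Proof.
move=> Kk t c.
have c0 : c 0%R = 1 by rewrite /c /= mulg1 invg1.
have cS d e : c (d + e)%R = c d ^ zpow t e * c e.
  by rewrite /c !zpowD invgM conjgE !mulgA mulgK.
have c1 : c 1%R = k by rewrite /c !zpow1 mulKg.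
have tJ l : core x l -> core x (l ^ t) by apply: core_word.
have tVJ l : core x l -> core x (l ^ t^-1).
  move=> Kl; suff -> : l ^ t^-1 = l ^ word_val x (word_scale (-1) w1).
    exact: core_word.
  rewrite -(core_zpow _ Kl) word_deg_scale deg_w1 mulr1 //.
have Kc d : core x (c d).
  elim/int_step_ind: d => [|d]; first by rewrite c0; apply: core1.
  rewrite addrC cS zpow1 c1; split=> [Kc|Kc].
    by apply: coreM => //; apply: tJ.
  (* Downwards, [c d] is recovered from [c (d + 1) = c d ^ t * k]. *)
  by rewrite -(conjgK t (c d)) -(mulgK k (c d ^ t)); apply/tVJ/coreM/coreV.
split=> //; elim: v => [|[i m] v IH] /=; first by rewrite c0 mulg1.
have cJ d u : c d ^ zpow t (wdeg u) = c d ^ word_val x u by apply: core_zpow.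
suff -> : zpow (twist x k i) m = zpow (x i) m * c (m * deg i)%R.
  by rewrite IH cS cJ conjgE -!mulgA mulVKg.
have yi : twist x k i = x i * c (deg i) by rewrite /twist -/t -mulgA.
elim/int_step_ind: m => [|m]; first by rewrite mul0r c0 mulg1.
have cJi d l : c d ^ zpow t (l * deg i) = c d ^ zpow (x i) l.
  by have := cJ d [:: (i, l)]; rewrite /= addr0 mulg1.
rewrite !zpow_succ mulrDl mul1r cS cJi yi conjgE -!mulgA mulVKg.
by split=> [->|/mulgI/mulgI/mulgI].
Qed.

Lemma twist_twisted x k : core x k -> twisted x (twist x k).
Proof.
move=> Kk; exists (fun d => (zpow (word_val x w1) d)^-1 * zpow (word_val x w1 * k) d).
split=> [|v]; last by have [_] := twist_word v Kk.
by have [] := twist_word [::] Kk.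
Qed.

(** As [w1] has degree 1, its value recovers [k]; this makes the block of twists a copy of the
    core. *)
Lemma twist_w1 x k : core x k -> word_val (twist x k) w1 = word_val x w1 * k.
Proof. by case/(twist_word w1) => _ ->; rewrite deg_w1 !zpow1 mulKg. Qed.

Lemma twist_inj x k l : core x k -> core x l -> twist x k = twist x l -> k = l.
Proof.
move=> Kk Kl /(congr1 (word_val^~ w1)); rewrite !twist_w1 //; exact: mulgI.
Qed.

(** Evaluate [u ++ v] at [y] as one word and as a product. *)
Lemma twisted_cocycle x y c : (forall v, word_val y v = word_val x v * c (wdeg v)) ->
  forall u v, c (wdeg u + wdeg v)%R = c (wdeg u) ^ word_val x v * c (wdeg v).
Proof.
move=> yE u v; apply: (mulgI (word_val x (u ++ v))).
rewrite -word_deg_cat -yE !word_val_cat !yE conjgE !mulgA.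
by congr (_ * _); rewrite -!mulgA mulVKg.
Qed.

(** By the cocycle rule a correction is determined by its value in degree 1, so [k] has to be
    [c 1]. *)
Lemma twisted_twist x y : twisted x y -> exists2 k, core x k & y = twist x k.
Proof.
move=> [c [Kc yE]]; exists (c 1%R) => //.
have [c' [Kc' y'E]] := twist_twisted (Kc 1%R).
suff cc' d : c d = c' d.
  by apply: funext => i; rewrite -(word_val_letter y) yE cc' -y'E word_val_letter.
have cc'1 : c 1%R = c' 1%R.
  have := y'E w1; rewrite twist_w1 // deg_w1; exact: mulgI.
elim/int_step_ind: d => [|d].
  have := yE [::]; have := y'E [::]; rewrite /= !mul1g => <-; exact.
have w1d : wdeg (word_scale d w1) = d by rewrite word_deg_scale deg_w1 mulr1.
have := twisted_cocycle yE w1 (word_scale d w1).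
have := twisted_cocycle y'E w1 (word_scale d w1).
rewrite deg_w1 w1d => -> ->; rewrite cc'1.
by split=> [-> //|/mulgI].
Qed.

(** * Classes for twisting followed by conjugation, and their size *)

Definition related x z := exists2 h, H h & exists2 y, twisted x y & z = conjugate y h.

Lemma related_refl x : related x x.
Proof. by exists 1 => //; exists x; [apply: twisted_refl | rewrite conjugate1]. Qed.

Lemma related_sym x z : related x z -> related z x.
Proof.
move=> [h Hh [y Txy ->]]; exists h^-1; first exact: HV.
exists (conjugate x h); first exact/twistedJ/twisted_sym.
by rewrite -conjugateM mulgV conjugate1.
Qed.

Lemma related_trans x y z : related x y -> related y z -> related x z.
Proof.
move=> [g Hg [x' Txx' ->]] [h Hh [y' Ty' ->]].
exists (g * h); first exact: HM.
(* Both twists are made before conjugating: the second one is pulled back along [g]. *)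
exists (conjugate y' g^-1); last first.
  by rewrite conjugateM -(conjugateM y') mulVg conjugate1.
apply: twisted_trans Txx' _; have := twistedJ (HV Hg) Ty'.
by rewrite -conjugateM mulgV conjugate1.
Qed.

(** The product of index and order of the core is realised by a bijection: for each class
    representative [x], write [h = k * r] with [k] in the core and [r] the chosen representative of
    its coset, and send [h] to the twist of [x] by [k] conjugated by [r]. *)
Theorem card_dvd_twist_closed (Phi : (X -> gT) -> Prop) :
  (forall x h, H h -> Phi x -> Phi (conjugate x h)) ->
  (forall x y, twisted x y -> Phi x -> Phi y) ->
  card_dvd {h | H h} {x | Phi x}.
Proof.
move=> PhiJ PhiT.
have [rep [repP repE]] := equiv_repr related_refl related_sym related_trans.
have /choice[cosrep cosrepP] x : exists r : gT -> gT,
    (forall h, core x (h * (r h)^-1)) /\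
    (forall h g, core x (h * g^-1) -> r h = r g).
  apply: (@equiv_repr _ (fun h g => core x (h * g^-1))) => [h|h g|h g k].
  - by rewrite mulgV; apply: core1.
  - by move/coreV; rewrite invgF.
  - by move=> hg gk; have := coreM hg gk; rewrite mulgA mulgVK.
have crP x h : core x (h * (cosrep x h)^-1) by have [] := cosrepP x.
have crE x h g : core x (h * g^-1) -> cosrep x h = cosrep x g.
  by have [_] := cosrepP x; apply.
have Hcr x h : H h -> H (cosrep x h).
  move=> Hh; have := HM (HV (core_sub (crP x h))) Hh.
  by rewrite invgF mulgVK.
(* The part of [h] in [core x] twists; its coset representative conjugates. *)
pose F x h := conjugate (twist x (h * (cosrep x h)^-1)) (cosrep x h).
have PhiF x h : Phi x -> H h -> Phi (F x h).
  by move=> Px Hh; apply: PhiJ; [apply: Hcr | apply: PhiT (twist_twisted _) Px].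
exists {x | Phi x /\ rep x = x}.
exists (fun p => exist Phi (F (sval p.2) (sval p.1))
  (PhiF _ _ (proj1 (svalP p.2)) (svalP p.1))).
apply: inj_surj_bij => [[[h Hh] [x [Px rx]]] [[g Hg] [y [Py ry]]]|[z Pz]].
  move=> /(congr1 sval)/= eF.
  have relF w a : H a -> related w (F w a).
    move=> Ha; exists (cosrep w a); first exact: Hcr.
    by exists (twist w (a * (cosrep w a)^-1)) => //; apply: twist_twisted.
  have exy : x = y.
    rewrite -rx -ry; apply: repE; apply: related_trans (relF x h Hh) _.
    by rewrite eF; apply/related_sym/relF.
  subst y; have ecr : cosrep x h = cosrep x g.
    have [Tx Tg] := (twist_twisted (crP x h), twist_twisted (crP x g)).
    (* This quotient conjugates one twist of [x] into another, so [core_stab] applies at the first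
       twist, whose core is that of [x]. *)
    have K : core x (cosrep x h * (cosrep x g)^-1).
      apply: twisted_core_sub (twisted_sym Tx) _; apply: core_stab.
        exact/HM/HV/Hcr/Hg/Hcr.
      apply: twisted_trans (twisted_sym Tx) _.
      rewrite conjugateM -/(F x h) eF /F -conjugateM mulgV conjugate1.
      exact: Tg.
    have rr a : cosrep x (cosrep x a) = cosrep x a by apply/esym/crE.
    by rewrite -(rr h) -(rr g); apply: crE.
  have egh : h = g.
    move/(congr1 (conjugate^~ (cosrep x h)^-1)): eF.
    rewrite /F ecr -!conjugateM mulgV !conjugate1 -{1}ecr.
    by move/twist_inj => /(_ (crP _ _) (crP _ _)); rewrite ecr; apply: mulIg.
  by congr pair; apply: eq_exist.
have rz : rep (rep z) = rep z by apply/esym/repE.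
have Rzz := related_sym (repP z); set x := rep z in rz Rzz.
have Px : Phi x.
  have [h Hh [y Tzy xE]] := repP z; rewrite -/x in xE.
  by rewrite xE; apply: PhiJ => //; apply: PhiT Tzy Pz.
have [h Hh [y Txy zE]] := Rzz.
(* The core part [k0] of [h] conjugates [y] to another twist of [x], say by [k1]; the preimage of
   [z] is then [k1 * r]. *)
pose r := cosrep x h; pose k0 := h * r^-1.
have Tk0 : twisted x (conjugate y k0).
  apply: (twisted_trans Txy); apply: twisted_core_conj.
  exact: twisted_core_sub Txy (crP x h).
have [k1 Kk1 k1E] := twisted_twist Tk0.
have Hk1 : H (k1 * r) by apply: HM (core_sub Kk1) (Hcr _ _ Hh).
exists (exist _ _ Hk1, exist _ x (conj Px rz)).
apply: eq_exist; rewrite /=.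
have -> : z = conjugate (twist x k1) r.
  by rewrite -k1E -conjugateM /k0 mulgVK.
have er : cosrep x (k1 * r) = r.
  by apply/esym/crE; rewrite invgM mulgA; apply: coreM (crP _ _) (coreV Kk1).
by rewrite /F er mulgK.
Qed.

End Twists.

(** * The group of units of a ring *)

Definition inverse_pair (R : pzRingType) : pred (R * R) :=
  fun u => (u.1 * u.2 == 1) && (u.2 * u.1 == 1).

(** A unit carries its inverse, so that inversion is a swap; uniqueness of inverses makes the first
    component determine the pair. *)
Definition unit_pair (R : pzRingType) : Type := {u : R * R | inverse_pair u}.
HB.instance Definition _ (R : pzRingType) := Choice.on (unit_pair R).

Section UnitPair.
Context {R : pzRingType}.
Implicit Types a b c : unit_pair R.

Lemma unit_pairP a : (val a).1 * (val a).2 = 1 /\ (val a).2 * (val a).1 = 1.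
Proof. by case: a => u /= /andP[/eqP ? /eqP ?]. Qed.

Lemma unit_pair_fst_inj a b : (val a).1 = (val b).1 -> a = b.
Proof.
have [_ a21] := unit_pairP a; have [b12 _] := unit_pairP b.
move=> eab; apply: val_inj; apply/eqP; rewrite -pair_eqE /= eab eqxx /=.
have <- : (val a).2 * ((val b).1 * (val b).2) = (val a).2 by rewrite b12 mulr1.
by rewrite mulrA -eab a21 mul1r.
Qed.

Fact mul_unit_pair_subproof a b :
  inverse_pair ((val a).1 * (val b).1, (val b).2 * (val a).2).
Proof.
have [a12 a21] := unit_pairP a; have [b12 b21] := unit_pairP b.
rewrite /inverse_pair /= -mulrA (mulrA (val b).1) b12 mul1r a12 eqxx /=.
by rewrite -mulrA (mulrA (val a).2) a21 mul1r b21.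
Qed.

Fact one_unit_pair_subproof : inverse_pair (1 : R, 1 : R).
Proof. by rewrite /inverse_pair mulr1 eqxx. Qed.

Fact inv_unit_pair_subproof a :
  inverse_pair ((val a).2, (val a).1).
Proof. by rewrite /inverse_pair; have [/= -> ->] := unit_pairP a; rewrite eqxx. Qed.

Definition mul_unit_pair a b : unit_pair R :=
  exist (@inverse_pair R) _ (mul_unit_pair_subproof a b).
Definition one_unit_pair : unit_pair R :=
  exist (@inverse_pair R) (1, 1) one_unit_pair_subproof.
Definition inv_unit_pair a : unit_pair R :=
  exist (@inverse_pair R) _ (inv_unit_pair_subproof a).

Fact mul_unit_pairA : associative mul_unit_pair.
Proof. by move=> a b c; apply: unit_pair_fst_inj; rewrite /= mulrA. Qed.
Fact mul1_unit_pair : left_id one_unit_pair mul_unit_pair.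
Proof. by move=> a; apply: unit_pair_fst_inj; rewrite /= mul1r. Qed.
Fact mul_unit_pair1 : right_id one_unit_pair mul_unit_pair.
Proof. by move=> a; apply: unit_pair_fst_inj; rewrite /= mulr1. Qed.
Fact mulV_unit_pair : left_inverse one_unit_pair inv_unit_pair mul_unit_pair.
Proof. by move=> a; apply: unit_pair_fst_inj; have [] := unit_pairP a. Qed.
Fact mul_unit_pairV : right_inverse one_unit_pair inv_unit_pair mul_unit_pair.
Proof. by move=> a; apply: unit_pair_fst_inj; have [] := unit_pairP a. Qed.

HB.instance Definition _ := isGroup.Build (unit_pair R) mul_unit_pairA
  mul1_unit_pair mul_unit_pair1 mulV_unit_pair mul_unit_pairV.

Definition uval a : R := (val a).1.

Lemma uval_inj : injective uval. Proof. exact: unit_pair_fst_inj. Qed.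

Lemma uvalM a b : uval (a * b)%g = uval a * uval b. Proof. by []. Qed.

Lemma uval1 : uval 1%g = 1. Proof. by []. Qed.

Lemma uvalV a : uval a * uval a^-1%g = 1 /\ uval a^-1%g * uval a = 1.
Proof. exact: unit_pairP. Qed.

Lemma uvalX a m : uval (a ^+ m)%g = uval a ^+ m.
Proof. by elim: m => // m IH; rewrite expgS exprS uvalM IH. Qed.

Lemma uval_zpow a k : uval (zpow a k) = ipow (uval a) (uval a^-1)%g k.
Proof. by case: k => m; rewrite /= -?uvalX -?expVgn. Qed.

Lemma uvalK a b : uval a * uval (a^-1 * b)%g = uval b.
Proof. by rewrite -uvalM mulVKg. Qed.

Lemma uval_pairE (a b : R) : a * b = 1 -> b * a = 1 ->
  exists2 u : unit_pair R, uval u = a & uval (u^-1)%g = b.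
Proof.
move=> ab ba; have p : inverse_pair (a, b) by rewrite /inverse_pair ab ba eqxx.
by exists (exist (@inverse_pair R) (a, b) p).
Qed.

End UnitPair.

(** * Terms and equations under conjugation and twisting *)

Section UnitSolutions.
Context {R : pzRingType} {n : nat}.
Implicit Types (x y : 'I_n -> unit_pair R) (t : term R n) (h k : unit_pair R).

Definition ueval_term x t := eval_term (uval \o x) (fun i => uval (x i)^-1%g) t.

Definition ueval_eq x (e : equation R n) :=
  eval_eq (uval \o x) (fun i => uval (x i)^-1%g) e.

Definition term_word t := [seq (f.1.2, f.2) | f <- t].

Lemma ueval_term_cons x (f : factor R n) t :
  ueval_term x (f :: t) = f.1.1 * uval (zpow (x f.1.2) f.2) * ueval_term x t.
Proof. by rewrite uval_zpow. Qed.

Lemma ueval_eq_cons x t e : ueval_eq x (t :: e) = ueval_term x t + ueval_eq x e.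
Proof. by []. Qed.

Lemma ueval_termJ x t h :
  (forall f, f \in t -> GRing.comm (uval h) f.1.1) ->
  uval h * ueval_term (conjugate x h) t = ueval_term x t * uval h.
Proof.
elim: t => [|f t IH] hC; first by rewrite mulr1 mul1r.
have cf : uval h * uval (zpow (conjugate x h f.1.2) f.2)
    = uval (zpow (x f.1.2) f.2) * uval h.
  by rewrite -zpowJ conjgE uvalK.
rewrite !ueval_term_cons !mulrA (hC f) ?mem_head // -(mulrA _ (uval h)) cf.
rewrite -!mulrA IH ?mulrA // => g gt.
by apply: hC; rewrite inE gt orbT.
Qed.

Lemma ueval_eqJ x e h :
  (forall t f, t \in e -> f \in t -> GRing.comm (uval h) f.1.1) ->
  uval h * ueval_eq (conjugate x h) e = ueval_eq x e * uval h.
Proof.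
elim: e => [|t e IH] hC; first by rewrite mulr0 mul0r.
rewrite !ueval_eq_cons mulrDr mulrDl ueval_termJ ?IH // => [s f se|f];
  by apply: hC; rewrite inE ?se ?eqxx ?orbT.
Qed.

Context (deg : 'I_n -> int) (H : unit_pair R -> Prop).

(** Moving right, [k] commutes with each coefficient because it lies in [H], and is conjugated by
    each power of an unknown, which leaves it in the core. *)
Lemma core_ueval_term x t k :
  (forall h f, H h -> f \in t -> GRing.comm (uval h) f.1.1) ->
  core deg H x k ->
  uval k * ueval_term x t
    = ueval_term x t * uval (k ^ word_val x (term_word t))%g.
Proof.
elim: t k => [|f t IH] k HC Kk; first by rewrite mulr1 mul1r conjg1.
have Kf : core deg H x (k ^ zpow (x f.1.2) f.2)%g.
  by have := core_word [:: (f.1.2, f.2)] Kk; rewrite /= mulg1.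
rewrite ueval_term_cons /= conjgM !mulrA (HC k f) ?mem_head //; last first.
  exact: core_sub Kk.
rewrite -[_ * uval k * _]mulrA -uvalM conjgC uvalM mulrA -[LHS]mulrA IH ?mulrA //.
by move=> h g Hh gt; apply: HC; rewrite // inE gt orbT.
Qed.

(** The correction of each factor is pushed to the right end of the term, where the cocycle rule
    merges it with the others. *)
Lemma twisted_ueval_term x y c t :
  (forall h f, H h -> f \in t -> GRing.comm (uval h) f.1.1) ->
  (forall d, core deg H x (c d)) ->
  (forall v, word_val y v = word_val x v * c (word_deg deg v))%g ->
  ueval_term y t = ueval_term x t * uval (c (word_deg deg (term_word t))).
Proof.
move=> HC Kc yE; elim: t HC => [|f t IH] HC.
  by have := yE [::]; rewrite /= mul1g => <-; rewrite uval1 mulr1.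
have yf := yE [:: (f.1.2, f.2)]; rewrite /= !mulg1 addr0 in yf.
have HC' : forall h g, H h -> g \in t -> GRing.comm (uval h) g.1.1.
  by move=> h g Hh gt; apply: HC; rewrite // inE gt orbT.
rewrite !ueval_term_cons yf uvalM IH // !mulrA.
rewrite -[_ * uval (c _) * ueval_term x t]mulrA core_ueval_term //.
rewrite (mulrA (f.1.1 * _) (ueval_term x t)) -[LHS]mulrA -uvalM.
have := twisted_cocycle yE [:: (f.1.2, f.2)] (term_word t).
by rewrite /= addr0 => ->.
Qed.

End UnitSolutions.

(** * Passage from the ring to its group of units, and closure of the solution set *)

Theorem mainTheorem9 (R : pzRingType) (G : R -> Prop) (n : nat) (I : Type)
  (E : I -> equation R n) :
  unit_subgroup G ->
  gen_homogeneous E ->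
  card_dvd {g : R | G g /\ centralises (coeff_of E) g}
           {x : 'I_n -> R | sol_in E G x}.
Proof.
move=> [G1 GM GV] [deg [[j degj] degE]].
have [w wdvd] := word_deg_dvd deg; set d := word_deg deg w in wdvd.
(* Division by the gcd [d], nonzero since [deg j] is, turns [w] into a word of degree 1. *)
pose q i := (deg i %/ d)%Z.
have degq i : deg i = q i * d by rewrite /q divzK.
have wordq v : word_deg deg v = word_deg q v * d.
  by elim: v => [|f v IH] /=; rewrite ?mul0r // IH degq mulrDl mulrA.
have d0 : d != 0 by apply: contraNneq degj => d0; rewrite degq d0 mulr0.
have w1 : word_deg q w = 1 by apply: (mulIf d0); rewrite -wordq mul1r.
have termq t : term_deg deg t = word_deg q (term_word t) * d.
  rewrite -wordq; elim: t => [//|f t IH] /=; by rewrite -IH.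
have Gunit g : G g -> exists2 u : unit_pair R, uval u = g & G (uval u^-1%g).
  move=> Gg; have [b Gb [gb bg]] := GV g Gg.
  by have [u ug ub] := uval_pairE gb bg; exists u; rewrite ?ub.
have GVu (u : unit_pair R) : G (uval u) -> G (uval u^-1%g).
  by move=> /Gunit[v /uval_inj ->].
pose H (u : unit_pair R) := G (uval u) /\ centralises (coeff_of E) (uval u).
pose Phi (x : 'I_n -> unit_pair R) :=
  (forall i, G (uval (x i))) /\ (forall e, ueval_eq x (E e) = 0).
have HC h e t f : H h -> t \in E e -> f \in t -> GRing.comm (uval h) f.1.1.
  by move=> [_ hC] te ft; apply: hC; exists e, t => //; exists f.
have [F Fbij] : exists F : {u | H u} -> {g | G g /\ centralises (coeff_of E) g},
    bijective F.
  apply: (sig_bij uval_inj) => // g [Gg gC].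
  by have [u ug _] := Gunit g Gg; exists u; rewrite // /H ug.
have [K Kbij] : exists K : {x | Phi x} -> {x | sol_in E G x}, bijective K.
  apply: (@sig_bij _ _ _ _ (fun x i => uval (x i))).
  - move=> x y /= exy; apply: funext => i; apply: uval_inj.
    exact: (congr1 (fun z => z i) exy).
  - move=> x [Gx sx]; split=> //; exists (fun i => uval (x i)^-1%g); split=> // i.
    exact: uvalV.
  move=> x [Gx [x' [xx' sx]]].
  have /choice[u uP] i : exists u : unit_pair R, uval u = x i /\ uval u^-1%g = x' i.
    by have [xi ix] := xx' i; have [u ? ?] := uval_pairE xi ix; exists u.
  have ex : (fun i => uval (u i)) = x by apply: funext => i; have [] := uP i.
  have ex' : (fun i => uval (u i)^-1%g) = x' by apply: funext => i; have [] := uP i.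
  exists u => //; split=> [i|e]; first by have [-> _] := uP i.
  by rewrite /ueval_eq ex' /comp ex.
apply: (card_dvd_bij Fbij Kbij).
have H1 : H 1%g by split=> // s _; rewrite mul1r mulr1.
have HM a b : H a -> H b -> H (a * b)%g.
  move=> [Ga aC] [Gb bC]; split=> [|s Ss]; first exact: GM.
  by rewrite uvalM -mulrA bC // mulrA aC // mulrA.
have HV a : H a -> H a^-1%g.
  move=> [Ga aC]; split=> [|s Ss]; first exact: GVu.
  have [a12 a21] := uvalV a.
  by rewrite -[RHS]mul1r -a21 -mulrA (mulrA _ s) aC // -(mulrA s) a12 mulr1.
apply: (card_dvd_twist_closed w1 H1 HM HV) => [x h Hh [Gx sx]|x y [c [Kc yE]] [Gx sx]].
  have [Gh _] := Hh; split=> [i|e].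
    by rewrite /conjugate conjgE !uvalM; apply: (GM _ _ (GVu _ Gh) (GM _ _ _ Gh)).
  have := ueval_eqJ x (fun t f => @HC h e t f Hh); rewrite sx mul0r => e0.
  have [_ h21] := uvalV h.
  by rewrite -[LHS]mul1r -h21 -mulrA e0 mulr0.
split=> [i|e].
  have := yE [:: (i, 1)]; rewrite !word_val_letter => ->.
  by rewrite uvalM; apply: GM => //; have [] := core_sub (Kc (word_deg q [:: (i, 1)])).
(* Homogeneity makes the correction common to all terms of the equation; for an empty equation 1
   serves. *)
have [c' c'E] : exists c', forall t, t \in E e -> c (word_deg q (term_word t)) = c'.
  case Ee: (E e) => [|t0 e']; first by exists 1%g.
  exists (c (word_deg q (term_word t0))) => t te; congr c; apply: (mulIf d0).
  by rewrite -!termq; apply: (degE e); rewrite Ee // mem_head.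
suff -> : ueval_eq y (E e) = ueval_eq x (E e) * uval c' by rewrite sx mul0r.
(* The induction runs over lists of terms from [E e], while membership still refers to the full
   equation. *)
have : {subset E e <= E e} by [].
elim: {1 3 4}(E e) => [|t s IH] sub; first by rewrite mul0r.
rewrite !ueval_eq_cons mulrDl IH; last by move=> r rs; apply: sub; rewrite inE rs orbT.
have te : t \in E e by apply: sub; rewrite mem_head.
congr (_ + _); rewrite -(c'E t te); apply: (twisted_ueval_term _ Kc yE).
by move=> h f Hh ft; apply: (HC h e t f).
Qed.
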